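(* Let $n\ge 1$, $\alpha\in(0,1)$, let $p=(p_1,\dots,p_n)$ be a $[0,1]^n$-valued random vector of p-values, and let $\{1,\dots,n\}=I_0\cup I_1$ be a disjoint union with $n_0=|I_0|>0$. Assume $\mathbb{E}\left[\sum_{i\in I_0}\mathbb{I}(p_i\le t)\right]\le n_0t$ for all $t\in[0,1)$. Let $\beta_i=\frac{i\alpha}{n+1-i(1-\alpha)}$, $1\le i\le n$, and $T=\{0,\beta_1,\dots,\beta_n\}$. Suppose that the process $$M_{I_0}(t)=\sum_{i\in I_0}\frac{\mathbb{I}(p_i\le t)-t}{1-t},\qquad t\in T,$$ is a martingale with respect to the filtration $\mathcal{F}_t^f=\sigma\left(\mathbb{I}(p_i\le s),\,p_j:\ s\le t,\ s\in T,\ i\in I_0,\ j\in I_1\right)$, $t\in T$. Then, for the step down test based on the critical values $\beta_i$, $i\le n$, with critical boundary value $\tau_{SD}$, $$\mathbb{E}\left[\frac{V(\tau_{SD})}{R(\tau_{SD})}\right]\le\mathbb{E}\left[\frac{V(\tau_{SD})}{S(\tau_{SD})+1}\right]\le\frac{\alpha}{1-\alpha},$$ which implies $$\mathbb{E}\left[\frac{V(\tau_{SD})}{R(\tau_{SD})}\right]\le\frac{\alpha}{1-\alpha}-\mathbb{E}\left[\frac{V(\tau_{SD})\left(V(\tau_{SD})-1\right)}{R(\tau_{SD})\left(S(\tau_{SD})+1\right)}\right].$$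
   Context: $I_0$ is the index set of true null hypotheses and $I_1$ that of false ones. $p_{1:n}\le\dots\le p_{n:n}$ denote the ordered p-values. The step down (SD) critical boundary value is $\tau_{SD}=\max\{\beta_i: p_{j:n}\le\beta_j \text{ for all } j\le i\}$ with $\max\emptyset=0$. $V(\tau)=\sum_{i\in I_0}\mathbb{I}(p_i\le\tau)$, $S(\tau)=\sum_{i\in I_1}\mathbb{I}(p_i\le\tau)$, $R(\tau)=V(\tau)+S(\tau)$. Convention: $\frac00=0$. $\mathbb{I}(\cdot)$ is the indicator function. *)

(* Defs.v *)
From HB Require Import structures.
From mathcomp Require Import all_boot all_order all_algebra.
From mathcomp Require Import all_classical all_reals all_analysis.

Set Implicit Arguments.
Unset Strict Implicit.
Unset Printing Implicit Defensive.

Import Order.TTheory GRing.Theory Num.Theory.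
Import numFieldNormedType.Exports.

Local Open Scope classical_set_scope.
Local Open Scope ring_scope.

Section conditional_expectation.
Context d (Omega : measurableType d) (R : realType) (P : probability Omega R).

Definition sub_sigma_algebra_of (G : set_system Omega) : Prop :=
  sigma_algebra [set: Omega] G /\ G `<=` @measurable d Omega.

Definition measurable_wrt (G : set_system Omega) (X : Omega -> R) : Prop :=
  preimage_set_system [set: Omega] X measurable `<=` G.

(* sigma(X : X in K) *)
Definition sigma_generated_by (K : set (Omega -> R)) : set_system Omega :=
  <<s \bigcup_(X in K) preimage_set_system [set: Omega] X measurable >>.

(* Y is a version of E[X | G] *)
Definition is_cond_expectation (G : set_system Omega) (X Y : Omega -> R)
    : Prop :=
  [/\ measurable_wrt G Y,
      P.-integrable [set: Omega] (EFin \o Y) &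
      forall A, G A ->
        (\int[P]_(w in A) (Y w)%:E = \int[P]_(w in A) (X w)%:E)%E].

Definition filtration (T : set R) (F : R -> set_system Omega) : Prop :=
  (forall t, T t -> sub_sigma_algebra_of (F t)) /\
  (forall s t, T s -> T t -> s <= t -> F s `<=` F t).

Definition martingale (T : set R) (F : R -> set_system Omega)
    (M : R -> Omega -> R) : Prop :=
  [/\ filtration T F,
      forall t, T t -> measurable_wrt (F t) (M t),
      forall t, T t -> P.-integrable [set: Omega] (EFin \o M t) &
      forall s t, T s -> T t -> s <= t ->
        is_cond_expectation (F s) (M t) (M s)].

End conditional_expectation.

Section step_down.
Context d (Omega : measurableType d) (R : realType) (n : nat).
Variable p : 'I_n -> Omega -> R.

(* #{i in I : p_i <= t}: this is V(t) for I = I_0 and S(t) for I = I_1 *)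
Definition pcount (I : {set 'I_n}) (t : R) (w : Omega) : R :=
  \sum_(i in I) (p i w <= t)%R%:R.

(* p_{j:n}, the j-th smallest p-value, for 1 <= j <= n *)
Definition ordered_pvalue (w : Omega) (j : nat) : R :=
  nth 0 (sort <=%R [seq p i w | i <- enum 'I_n]) j.-1.

(* The critical values beta_1, ..., beta_n are nonnegative in all uses, so that
   the neutral element 0 only matters for the maximum of the empty set. *)
Definition tau_SD (beta : nat -> R) (w : Omega) : R :=
  \big[Num.max/0]_(1 <= i < n.+1 |
      all (fun j => ordered_pvalue w j <= beta j) (iota 1 i)) beta i.

Definition M_null (I0 : {set 'I_n}) (t : R) (w : Omega) : R :=
  \sum_(i in I0) ((p i w <= t)%R%:R - t) / (1 - t).

Definition filtration_f (T : set R) (I0 I1 : {set 'I_n}) (t : R)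
    : set_system Omega :=
  sigma_generated_by
    ([set X | exists i s, [/\ i \in I0, T s, s <= t &
                              X = (fun w => (p i w <= s)%R%:R)]] `|`
     [set X | exists2 j, j \in I1 & X = p j]).

End step_down.

Definition beta_SD (R : realType) (n : nat) (alpha : R) (i : nat) : R :=
  i%:R * alpha / (n.+1%:R - i%:R * (1 - alpha)).

Definition time_set (R : realType) (n : nat) (beta : nat -> R) : set R :=
  [set t | t = 0 \/ exists2 i, (1 <= i <= n)%N & t = beta i].

(* Main.v *)
Require Import Defs.
From HB Require Import structures.
From mathcomp Require Import all_boot all_order all_algebra.
From mathcomp Require Import all_classical all_reals all_analysis.
From mathcomp Require Import ring lra zify.

Set Implicit Arguments.
Unset Strict Implicit.
Unset Printing Implicit Defensive.

Import Order.TTheory GRing.Theory Num.Theory.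
Import numFieldNormedType.Exports.

Local Open Scope classical_set_scope.
Local Open Scope ring_scope.

(** Write [V_j] and [S_j] for the numbers of true and of false null hypotheses
    with p-value at most [beta_j] ([beta_0 = 0]), let [U_j] be the event that
    [i <= V_i + S_i] for all [1 <= i <= j], and let [k] be the largest index
    with [U_k]. Then [tau_SD = beta_k] ([tau_SD_stop]). Put [n0 = #|I_0|] and
    [X_j = M_{I_0}(beta_j)]. The critical values are chosen so that
    [X_j = V_j - (n0 - V_j) * j * alpha / (n + 1 - j)] ([compensated_countE]).

    The event [U_j] belongs to [F_{beta_j}], so it is the index
    [min (k + 1) n], not [k], that is a stopping time. Nothing is lost by
    looking one step ahead: if [k < n], then at most [k] p-values lie below
    [beta_{k+1}] and at least [k] below [beta_k], so no count changes between
    these two times and [V_k + S_k = k] ([stop_total]). Inserting this into the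
    formula for [X] gives, with [c_j = 1 / (S_j + 1)] and [m = min (k + 1) n],
    [(1 - alpha) * V_k / (S_k + 1) - alpha <= c_m * X_m]
    ([le_compensated_stop]).

    It remains to see that [E(c_m * X_m) <= 0]. By telescoping, [c_m * X_m] is
    [c_0 * X_0] plus the sum over [j < n] of
    [1_{U_j} * c_{j+1} * (X_{j+1} - X_j) - 1_{U_j} * (c_j - c_{j+1}) * X_j].
    All the [S_j] are [F_0]-measurable, so the first term has mean zero by the
    martingale property. The second has mean at most zero because
    [E(f * 1_{U_j} * X_j) >= 0] for every nonnegative [F_0]-measurable [f]
    ([mean_reached_ge0]): although [X_j] may be negative on [U_j], stopping at
    the boundary removes only negative values whenever the boundary value is
    itself negative. Finally [X_0 = V_0], which has mean zero since the bound
    on the null p-values at [t = 0] gives [E V_0 <= 0].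

    All these quantities depend on a sample point only through the finitely
    many indicators of [p_i <= beta_j]. The argument is therefore carried out
    with finite weighted sums over the possible values of this array
    ([mean_ratio_le]), and the measure theory reduces to two facts: integrals
    of functions of the array are such sums ([integral_finite_valued]), and the
    part of the array visible at time [beta_j] generates events of
    [F_{beta_j}] ([filtration_f_truncate]). The other two inequalities are
    pointwise ([ratio_le], [ratioE]). *)

(** * The critical values *)

Section critical_values.
Variables (R : realType) (n : nat) (alpha : R).
Hypotheses (alpha_gt0 : 0 < alpha) (alpha_lt1 : alpha < 1).

Let den_gt0 j : (j <= n)%N -> 0 < n.+1%:R - j%:R * (1 - alpha) :> R.
Proof.
move=> jn; have h : j%:R + 1 <= n.+1%:R :> R by rewrite natr1 ler_nat ltnS.
have h0 : 0 <= j%:R * alpha :> R by rewrite mulr_ge0// ltW.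
by rewrite mulrBr mulr1; lra.
Qed.

Lemma beta_SD0 : beta_SD n alpha 0 = 0.
Proof. by rewrite /beta_SD !mul0r. Qed.

Lemma one_sub_beta_SD j : (j <= n)%N ->
  1 - beta_SD n alpha j = (n.+1%:R - j%:R) / (n.+1%:R - j%:R * (1 - alpha)).
Proof.
move=> jn; have /lt0r_neq0 := den_gt0 jn; rewrite /beta_SD.
by move: n.+1%:R => m h; field.
Qed.

Lemma beta_SD_lt1 j : (j <= n)%N -> beta_SD n alpha j < 1.
Proof.
move=> jn; rewrite -subr_gt0 one_sub_beta_SD// divr_gt0 ?den_gt0//.
by rewrite subr_gt0 ltr_nat.
Qed.

Lemma beta_SD_lt i j : (i < j)%N -> (j <= n)%N ->
  beta_SD n alpha i < beta_SD n alpha j.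
Proof.
move=> ij jn; have inn : (i <= n)%N by exact: leq_trans (ltnW ij) jn.
rewrite /beta_SD ltr_pdivrMr ?den_gt0// mulrAC ltr_pdivlMr ?den_gt0//.
have -> : j%:R * alpha * (n.+1%:R - i%:R * (1 - alpha)) =
  i%:R * alpha * (n.+1%:R - j%:R * (1 - alpha)) +
  (j%:R - i%:R) * alpha * n.+1%:R :> R by ring.
by rewrite ltrDl !mulr_gt0// subr_gt0 ltr_nat.
Qed.

(** The reason for the choice of [beta_j]: its odds [beta_j / (1 - beta_j)] are
    [j * alpha / (n + 1 - j)]. *)
Lemma compensated_countE (N v : R) j : (j <= n)%N ->
  (v - N * beta_SD n alpha j) / (1 - beta_SD n alpha j) =
  v - (N - v) * (j%:R * alpha / (n.+1%:R - j%:R)).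
Proof.
move=> jn; rewrite one_sub_beta_SD// /beta_SD.
have := den_gt0 jn; have : 0 < n.+1%:R - j%:R :> R by rewrite subr_gt0 ltr_nat.
by move: n.+1%:R => m /lt0r_neq0 h1 /lt0r_neq0 h2; field; rewrite h1.
Qed.

End critical_values.

(** * The step down index *)

(** The largest index [i <= n] at which [Q] holds, and [0] if there is none. *)
Definition last_index (n : nat) (Q : pred nat) : nat := \max_(i < n.+1 | Q i) i.

Lemma last_index_le n Q : (last_index n Q <= n)%N.
Proof. by apply/bigmax_leqP => i _; rewrite -ltnS. Qed.

Lemma last_index_max n (Q : pred nat) i : (i <= n)%N -> Q i ->
  (i <= last_index n Q)%N.
Proof.
rewrite -ltnS => lt_in Qi.
exact: (bigop.bigmax_sup (Ordinal lt_in)).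
Qed.

Lemma last_indexP n (Q : pred nat) : Q 0%N -> Q (last_index n Q).
Proof.
move=> Q0; rewrite /last_index.
have [|i Qi ->//] := @eq_bigmax_cond _ (fun i : 'I_n.+1 => Q i) (fun i => i : nat).
by apply/card_gt0P; exists ord0.
Qed.

Section stopping_index.
Variables (T : finType) (n : nat) (V S : nat -> T -> nat).

(** The event [U_j] that the step down procedure gets as far as index [j]: at
    least [i] rejections are available at level [beta_i] for each
    [1 <= i <= j]. *)
Definition reached (j : nat) (x : T) : bool :=
  all (fun i => i <= V i x + S i x)%N (iota 1 j).

Lemma reachedS j x : reached j.+1 x = reached j x && (j < V j.+1 x + S j.+1 x)%N.
Proof. by rewrite /reached -[in iota 1 _](addn1 j) iotaD all_cat/= andbT add1n. Qed.

Lemma reached_le i j x : (i <= j)%N -> reached j x -> reached i x.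
Proof.
move=> ij /allP Uj; apply/allP => k; rewrite mem_iota => ki; apply: Uj.
by rewrite mem_iota; lia.
Qed.

(** The index at which the step down procedure ends. *)
Definition stop (x : T) : nat := last_index n (reached^~ x).

Lemma stop_le x : (stop x <= n)%N.
Proof. exact: last_index_le. Qed.

Lemma reachedE j x : (j <= n)%N -> reached j x = (j <= stop x)%N.
Proof.
move=> jn; apply/idP/idP => [|js]; first exact: last_index_max.
by apply: (reached_le js); exact: (@last_indexP n (reached^~ x)).
Qed.

Lemma leq_stop_total x : (stop x <= V (stop x) x + S (stop x) x)%N.
Proof.
have := @reachedE (stop x) x (stop_le x); rewrite leqnn.
by case: (stop x) => // k; rewrite reachedS => /andP[].
Qed.

End stopping_index.

(** * Weighted sums over a finite set of states *)

Section weighted_sum.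
Variables (R : realType) (T : finType) (pr : T -> R).

(** The expectation of [h] when the state [x] carries the mass [pr x]. *)
Definition mean (h : T -> R) : R := \sum_x pr x * h x.

Lemma meanD f g : mean (fun x => f x + g x) = mean f + mean g.
Proof. by rewrite /mean -big_split; apply: eq_bigr => x _; rewrite mulrDr. Qed.

Lemma mean_sum m (f : nat -> T -> R) :
  mean (fun x => \sum_(j < m) f j x) = \sum_(j < m) mean (f j).
Proof.
by rewrite /mean exchange_big; apply: eq_bigr => x _; rewrite mulr_sumr.
Qed.

Lemma ler_mean f g : (forall x, 0 <= pr x) ->
  (forall x, 0 < pr x -> f x <= g x) -> mean f <= mean g.
Proof.
move=> pr_ge0 fg; apply: ler_sum => x _.
have := pr_ge0 x; rewrite le_eqVlt => /predU1P[<-|px]; first by rewrite !mul0r.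
by rewrite ler_pM2l// fg.
Qed.

End weighted_sum.

(** * The optional stopping argument on a finite state space *)

Section finite_model.
Variables (R : realType) (T : finType) (pr : T -> R).
Variables (n n0 n1 : nat) (alpha : R).
Variables (V S : nat -> T -> nat) (res : nat -> T -> T).

Local Notation mean := (mean pr).

(** The null count at time [beta_j], compensated into a martingale: for
    [V j = #{i in I_0 : p_i <= beta_j}] and [n0 = #|I_0|] this is
    [M_{I_0}(beta_j)]. *)
Definition compensated (j : nat) (x : T) : R :=
  ((V j x)%:R - n0%:R * beta_SD n alpha j) / (1 - beta_SD n alpha j).

Local Notation U := (reached V S).
Local Notation stop := (stop n V S).
Local Notation X := compensated.

(* [res j x] keeps of the state [x] what is visible at time [beta_j]; all of
   [S] is visible at every time. Monotonicity is only required of the states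
   that carry mass. *)
Hypotheses (alpha_gt0 : 0 < alpha) (alpha_lt1 : alpha < 1).
Hypothesis pr_ge0 : forall x, 0 <= pr x.
Hypothesis pr_sum : \sum_x pr x = 1.
Hypothesis n01 : (n0 + n1 = n)%N.
Hypothesis V_le : forall j x, (V j x <= n0)%N.
Hypothesis S_le : forall j x, (S j x <= n1)%N.
Hypothesis V_mono : forall x j, 0 < pr x -> (j < n)%N -> (V j x <= V j.+1 x)%N.
Hypothesis S_mono : forall x j, 0 < pr x -> (j < n)%N -> (S j x <= S j.+1 x)%N.
Hypothesis V_res : forall i j x, (i <= j)%N -> V i (res j x) = V i x.
Hypothesis S_res : forall i j x, S i (res j x) = S i x.
Hypothesis V0_mean : mean (fun x => (V 0 x)%:R) <= 0.
Hypothesis X_mart : forall j y, (j < n)%N ->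
  \sum_(x | res j x == y) pr x * (X j.+1 x - X j x) = 0.

(** Martingale increments are orthogonal to functions of the past. *)
Lemma mean_martingale_incr j (g : T -> R) : (j < n)%N ->
  (forall x, g (res j x) = g x) ->
  mean (fun x => g x * (X j.+1 x - X j x)) = 0.
Proof.
move=> jn gres; rewrite /mean (partition_big (res j) predT)//= big1// => y _.
transitivity (g y * \sum_(x | res j x == y) pr x * (X j.+1 x - X j x)).
  rewrite mulr_sumr; apply: eq_bigr => x /eqP <-; rewrite gres; ring.
by rewrite X_mart// mulr0.
Qed.

Lemma reached_res i j x : (i <= j)%N -> U i (res j x) = U i x.
Proof.
move=> ij; apply: eq_in_all => k; rewrite mem_iota => /andP[_ ki].
by rewrite S_res V_res// (leq_trans _ ij).
Qed.

(** The mean of [X j] over the event that index [j] is reached is nonnegative,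
    also under nonnegative weights [f] known at time [0]. Reaching [j.+1] means
    that [V j.+1] is at least [j.+1 - S j.+1], which is known at time [0]. Where
    this boundary makes [X j.+1] nonnegative there is nothing to prove; where it
    makes [X j.+1] negative, [X j.+1] is negative on all states dropped between
    [j] and [j.+1], so the induction hypothesis carries over. *)
Lemma mean_reached_ge0 j (f : T -> R) : (j <= n)%N ->
  (forall i x, f (res i x) = f x) -> (forall x, 0 < pr x -> 0 <= f x) ->
  0 <= mean (fun x => f x * (U j x)%:R * X j x).
Proof.
elim: j f => [|j IH] f jn fres f_ge0.
  apply: sumr_ge0 => x _.
  have := pr_ge0 x; rewrite le_eqVlt => /predU1P[<-|px]; first by rewrite mul0r.
  rewrite /X beta_SD0 mulr0 !subr0 divr1.
  by apply: mulr_ge0 => //; rewrite !mulr_ge0// f_ge0.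
have beta1 : 0 < 1 - beta_SD n alpha j.+1 by rewrite subr_gt0 beta_SD_lt1.
(* [bad x]: at the boundary count [j.+1 - S j.+1 x], [X j.+1] is negative *)
pose bad (x : T) : bool := j.+1%:R - (S j.+1 x)%:R < n0%:R * beta_SD n alpha j.+1.
pose g x := f x * (bad x)%:R.
have gres i x : g (res i x) = g x by rewrite /g /bad fres S_res.
have g_ge0 x : 0 < pr x -> 0 <= g x by move=> px; rewrite mulr_ge0// f_ge0.
apply: le_trans (IH g (ltnW jn) gres g_ge0) _.
have gU_res x : g (res j x) * (U j (res j x))%:R = g x * (U j x)%:R.
  by rewrite gres reached_res.
have incr0 := @mean_martingale_incr j (fun x => g x * (U j x)%:R) jn gU_res.
rewrite -[leLHS]addr0 -incr0 -meanD; apply: ler_mean => // x px.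
have -> : g x * (U j x)%:R * X j x + g x * (U j x)%:R * (X j.+1 x - X j x) =
  g x * (U j x)%:R * X j.+1 x by ring.
rewrite reachedS /g; case: (U j x) => /=; last by rewrite !(mulr0, mul0r).
rewrite mulr1; case: (boolP (bad x)) => /= [|]; rewrite /bad => badx.
  rewrite mulr1; case: ltnP => /= VS; rewrite ?mulr1// mulr0 mul0r.
  (* a state dropped at [j.+1]: its count lies below the boundary *)
  rewrite mulr_ge0_le0 ?f_ge0//; apply: mulr_le0_ge0; last first.
    by rewrite invr_ge0 ltW.
  rewrite subr_le0; apply/ltW/(le_lt_trans _ badx).
  by rewrite lerBrDr -natrD ler_nat (leq_trans VS).
rewrite mulr0 mul0r; case: ltnP => /= VS; rewrite ?mulr0 ?mul0r//.
rewrite mulr1; apply: mulr_ge0; first exact: f_ge0.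
apply: divr_ge0; last exact: ltW.
rewrite subr_ge0; move: badx; rewrite -leNgt => /le_trans; apply.
by rewrite lerBlDr -natrD ler_nat.
Qed.

(** No p-value lies between the critical value where the procedure ends and the
    next one. *)
Lemma stop_total x : 0 < pr x -> (stop x < n)%N ->
  [/\ V (stop x).+1 x = V (stop x) x, S (stop x).+1 x = S (stop x) x &
      (V (stop x) x + S (stop x) x = stop x)%N].
Proof.
move=> px sn; have := V_mono px sn; have := S_mono px sn.
have := leq_stop_total n V S x.
have := @reachedE _ n V S (stop x).+1 x sn; rewrite ltnn => /negbT.
rewrite reachedS (@reachedE _ n) ?leqnn ?(ltnW sn)//= -leqNgt; clear; split; lia.
Qed.

(** For [stop x < n] this rests on [(n0 - V) / (n - (V + S)) <= 1]; for
    [stop x = n] everything is rejected and the compensated count is [n0]. *)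
Lemma le_compensated_stop x : 0 < pr x ->
  (1 - alpha) * ((V (stop x) x)%:R / ((S (stop x) x)%:R + 1)) - alpha <=
  X (minn (stop x).+1 n) x / ((S (minn (stop x).+1 n) x)%:R + 1).
Proof.
move=> px; set k := minn _ _; have S1 j : 0 < (S j x)%:R + 1 :> R by rewrite natr1.
have eqL (s v : R) : 0 < s ->
    (1 - alpha) * (v / s) - alpha = ((1 - alpha) * v - alpha * s) / s.
  by move=> /lt0r_neq0 s0; field.
rewrite eqL//; have [sn|] := ltnP (stop x) n; last first.
  move=> ns; have sE : stop x = n by apply/eqP; rewrite eqn_leq stop_le.
  have kE : k = n by rewrite /k sE; lia.
  have := leq_stop_total n V S x; rewrite kE sE => tot.
  have Vn : V n x = n0 by have := V_le n x; have := S_le n x; lia.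
  rewrite ler_pM2r ?invr_gt0// /X Vn compensated_countE// subrr mul0r subr0.
  have : 0 <= alpha * n0%:R by rewrite mulr_ge0// ltW.
  have : 0 <= alpha * ((S n x)%:R + 1) by rewrite mulr_ge0 ?ltW.
  by lra.
have kE : k = (stop x).+1 by rewrite /k; lia.
have [Vk Sk tot] := stop_total px sn.
rewrite kE Sk ler_pM2r ?invr_gt0// /X Vk compensated_countE//.
have Vle := V_le (stop x) x; have Sle := S_le (stop x) x.
set v := V (stop x) x in tot Vle *; set s := S (stop x) x in tot Sle *.
have dn : 0 < n.+1%:R - (stop x).+1%:R :> R by rewrite subr_gt0 ltr_nat.
have ks : (stop x).+1%:R = v%:R + s%:R + 1 :> R by rewrite -natr1 -tot natrD.
have q1 : (n0%:R - v%:R) / (n.+1%:R - (stop x).+1%:R) <= 1 :> R.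
  rewrite ler_pdivrMr// mul1r.
  have -> : n.+1%:R - (stop x).+1%:R = n0%:R + n1%:R - v%:R - s%:R :> R.
    by rewrite -tot -n01 -!natr1 !natrD; ring.
  have : s%:R <= n1%:R :> R by rewrite ler_nat.
  by lra.
have -> : (n0%:R - v%:R) * ((stop x).+1%:R * alpha / (n.+1%:R - (stop x).+1%:R))
  = (n0%:R - v%:R) / (n.+1%:R - (stop x).+1%:R) * ((stop x).+1%:R * alpha).
  by ring.
have a0 : 0 <= (stop x).+1%:R * alpha by rewrite mulr_ge0// ltW.
apply: le_trans (lerB (lexx _) (ler_wpM2r a0 q1)).
by rewrite mul1r ks; lra.
Qed.

(** Optional stopping at [minn (stop x).+1 n] for the weighted martingale
    [X j / (S j + 1)]. *)
Lemma mean_ratio_le :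
  mean (fun x => (V (stop x) x)%:R / ((S (stop x) x)%:R + 1)) <=
  alpha / (1 - alpha).
Proof.
have a1 : 0 < 1 - alpha by rewrite subr_gt0.
pose c j x : R := ((S j x)%:R + 1)^-1.
have c_res i j x : c i (res j x) = c i x by rewrite /c S_res.
have c_anti j x : 0 < pr x -> (j < n)%N -> c j.+1 x <= c j x.
  by move=> px jn; rewrite lef_pV2 ?posrE ?natr1// ler_nat ltnS S_mono.
have meanZ (a : R) f : mean (fun x => a * f x) = a * mean f.
  by rewrite /mean mulr_sumr; apply: eq_bigr => x _; ring.
have mean_cst (a : R) : mean (fun=> a) = a.
  by rewrite /mean -mulr_suml pr_sum mul1r.
rewrite ler_pdivlMr// mulrC -meanZ -subr_le0.
rewrite -[X in _ + X](mean_cst (- alpha)) -meanD.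
(* summed over [j < n], these increments telescope up to [minn (stop x).+1 n] *)
pose incr j x := (U j x)%:R * (c j.+1 x * X j.+1 x - c j x * X j x).
apply: (@le_trans _ _ (mean (fun x => c 0 x * X 0 x + \sum_(j < n) incr j x))).
  apply: ler_mean => // x px /=; apply: le_trans (le_compensated_stop px) _.
  rewrite [leLHS]mulrC -/(c _ x); set k := minn _ _.
  suff -> : \sum_(j < n) incr j x = c k x * X k x - c 0 x * X 0 x.
    by rewrite addrC subrK.
  have kn : (k <= n)%N by rewrite geq_minr.
  rewrite -(big_mkord xpredT (incr^~ x)) (big_cat_nat (n := k))//=.
  rewrite [X in _ + X]big_nat_cond [X in _ + X]big1 ?addr0; last first.
    move=> j /andP[/andP[kj jn] _]; rewrite /incr (@reachedE _ n) ?(ltnW jn)//.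
    by rewrite (_ : _ <= _ = false)%N ?mul0r//; move: kj; rewrite /k; lia.
  rewrite -(telescope_sumr (fun j => c j x * X j x))//.
  apply: eq_big_nat => j /andP[_ jk]; rewrite /incr (@reachedE _ n); last by lia.
  by rewrite (_ : _ <= _)%N ?mul1r//; move: jk; rewrite /k; lia.
rewrite meanD mean_sum -[leRHS]addr0; apply: lerD.
  apply: le_trans V0_mean; apply: ler_mean => // x px.
  rewrite /X beta_SD0 mulr0 !subr0 divr1.
  by rewrite ler_piMl// invf_le1 ?natr1// ler1n.
apply: sumr_le0 => j _.
have Uc_res x : (U j (res j x))%:R * c j.+1 (res j x) = (U j x)%:R * c j.+1 x :> R.
  by rewrite reached_res// c_res.
rewrite -(mean_martingale_incr (ltn_ord j) Uc_res) -subr_ge0 -mulN1r -meanZ -meanD.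
have := @mean_reached_ge0 j (fun x => c j x - c j.+1 x) (ltnW (ltn_ord j)).
move=> /(_ _ _)/le_trans; apply.
- by move=> i x; rewrite !c_res.
- by move=> x px; rewrite subr_ge0 c_anti.
by apply: ler_mean => // x px; rewrite /incr le_eqVlt; apply/orP; left; apply/eqP; ring.
Qed.

End finite_model.

(** * Integrals of functions of a finite-valued map *)

Section finite_valued.
Variables (d : measure_display) (Omega : measurableType d) (R : realType).
Variables (P : probability Omega R) (T : finType) (phi : Omega -> T).
Hypothesis mphi : forall x, measurable (phi @^-1` [set x]).

Lemma integral_finite_valued (h : T -> R) A : measurable A ->
  (\int[P]_(w in A) (h (phi w))%:E =
   (\sum_x fine (P (phi @^-1` [set x] `&` A)) * h x)%:E)%E.
Proof.
move=> mA; have fE w : (h (phi w))%:E =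
    (\sum_x (h x)%:E * (\1_(phi @^-1` [set x]) w)%:E)%E.
  rewrite (bigD1 (phi w))//= big1 ?adde0 => [|x xw].
    by rewrite indicE mem_set//= mule1.
  by rewrite indicE memNset ?mule0//= => xE; move: xw; rewrite xE eqxx.
under eq_integral do rewrite fE.
have ind x : P.-integrable A (fun w => (\1_(phi @^-1` [set x]) w)%:E).
  by apply: integrableS (integrable_indic _ (mphi x)).
rewrite integral_sum//; last by move=> x; exact: integrableZl.
rewrite -sumEFin; apply: eq_bigr => x _.
rewrite (integralZl _ (ind x))// integral_indic// EFinM fineK; first exact: muleC.
by apply: fin_num_measure; exact: measurableI.
Qed.

Lemma expectation_finite_valued (h : T -> R) :
  ('E_P[fun w => h (phi w)] =
  (mean (fun x => fine (P (phi @^-1` [set x]))) h)%:E)%E.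
Proof.
rewrite unlock integral_finite_valued//; congr _%:E.
by apply: eq_bigr => x _; rewrite setIT.
Qed.

End finite_valued.

(** * The array of threshold indicators *)

Section states.
Variables (d : measure_display) (Omega : measurableType d) (R : realType).
Variables (P : probability Omega R) (n : nat) (p : 'I_n -> {RV P >-> R}).
Variables (beta : nat -> R) (I0 I1 : {set 'I_n}).
Hypothesis I01_cover : (I0 :|: I1 = [set: 'I_n])%SET.
Hypothesis I01_disjoint : (I0 :&: I1 = finset.set0)%SET.

Local Notation state_type := {ffun 'I_n * 'I_n.+1 -> bool}.

(** The array of the indicators of [p_i <= beta_j], [j = 0, ..., n]. *)
Definition state (w : Omega) : state_type :=
  [ffun q : 'I_n * 'I_n.+1 => (p q.1 w <= beta q.2)%R].

(** The part of the array that is visible at time [beta_j]: the full rows of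
    the false null hypotheses, and the columns up to [j] of the true ones. The
    other entries are set to [false]. *)
Definition truncate (j : nat) (x : state_type) : state_type :=
  [ffun q : 'I_n * 'I_n.+1 => x q && ((q.1 \in I1) || (q.2 <= j)%N)].

(** The number of hypotheses in [I] with p-value at most [beta_j], read off the
    array; meaningful for [j <= n]. *)
Definition ncount (I : {set 'I_n}) (j : nat) (x : state_type) : nat :=
  (\sum_(i in I) x (i, inord j))%N.

Lemma pcount_state (I : {set 'I_n}) j w : (j <= n)%N ->
  pcount p I (beta j) w = (ncount I j (state w))%:R.
Proof.
move=> jn; rewrite /pcount /ncount natr_sum; apply: eq_bigr => i _.
by rewrite ffunE /= inordK.
Qed.

Lemma ncount_le I j x : (ncount I j x <= #|I|)%N.
Proof. by rewrite -sum1_card; apply: leq_sum => i _; case: (x _). Qed.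

Lemma ncountD j x :
  (ncount I0 j x + ncount I1 j x)%N = (\sum_(i < n) x (i, inord j))%N.
Proof.
have I01 : [disjoint I0 & I1]%B by rewrite -finset.setI_eq0 I01_disjoint.
rewrite /ncount -bigU//; apply: eq_bigl => i.
by rewrite !inE -finset.in_setU I01_cover finset.in_setT.
Qed.

Lemma ncount_truncate_null i j x : (i <= j)%N ->
  ncount I0 i (truncate j x) = ncount I0 i x.
Proof.
move=> ij; apply: eq_bigr => k _; rewrite ffunE/=.
(* an index [i > n] is read as [0] by [inord] *)
have -> : ((inord i : 'I_n.+1) <= j)%N by rewrite val_insubd; case: ifP.
by rewrite orbT andbT.
Qed.

Lemma ncount_truncate_alt i j x : ncount I1 i (truncate j x) = ncount I1 i x.
Proof. by apply: eq_bigr => k kI; rewrite ffunE/= kI andbT. Qed.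

Lemma ncount_mono I j w : (j < n)%N -> beta j <= beta j.+1 ->
  (ncount I j (state w) <= ncount I j.+1 (state w))%N.
Proof.
move=> jn bj; apply: leq_sum => i _.
have j1 : (j < n.+1)%N by exact: ltnW.
rewrite !ffunE /= !inordK//.
by case: (leP (p i w) (beta j)) => [/le_trans/(_ bj) ->|].
Qed.

Lemma measurable_pvalue_le i (t : R) : measurable [set w | (p i w <= t)%R].
Proof.
have -> : [set w | (p i w <= t)%R] = p i @^-1` [set` `]-oo, t]].
  by apply/seteqP; split => w /=; rewrite in_itv.
exact: measurable_funPTI.
Qed.

Lemma state_fibreE (f : state_type -> state_type) x :
  (f \o state) @^-1` [set x] =
  \bigcap_(q in [set: 'I_n * 'I_n.+1]) [set w | f (state w) q = x q].
Proof.
apply/seteqP; split => [w /= <- q _//|w h]; apply/ffunP => q; exact: h.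
Qed.

Lemma measurable_state x : measurable (state @^-1` [set x]).
Proof.
rewrite (state_fibreE id); apply: fin_bigcap_measurable; first exact: finite_finset.
move=> q _; have mq := measurable_pvalue_le q.1 (beta q.2).
case: (x q); last have {}mq := measurableC mq.
  by rewrite (_ : [set w | _] = [set w | (p q.1 w <= beta q.2)%R])//;
    apply/seteqP; split => w /=; rewrite ffunE.
by rewrite (_ : [set w | _] = ~` [set w | (p q.1 w <= beta q.2)%R])//;
    apply/seteqP; split => w /=; rewrite ffunE; [move->|move/negP/negbTE].
Qed.

(** The visible part of the array at time [beta_j] is [F_{beta_j}]-measurable. *)
Lemma filtration_f_truncate (T : set R) j x : (j <= n)%N ->
  (forall i, (i <= n)%N -> T (beta i)) ->
  {in [pred i | (i <= n)%N] &, {homo beta : i j / (i <= j)%N >-> i <= j}} ->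
  filtration_f p T I0 I1 (beta j) ((truncate j \o state) @^-1` [set x]).
Proof.
move=> jn Tb bmono; rewrite /filtration_f /sigma_generated_by.
set G := \bigcup_(X in _) _.
rewrite state_fibreE.
apply: (@fin_bigcap_measurable _ (g_sigma_algebraType G)).
  exact: finite_finset.
move=> q _.
have [qj|qj] := boolP ((q.1 \in I1) || (q.2 <= j)%N); last first.
  have -> : [set w | truncate j (state w) q = x q] = [set _ | false = x q].
    by apply/seteqP; split => w /=; rewrite ffunE (negbTE qj) andbF.
  case: (x q); first by rewrite (_ : [set _ | _] = set0)//; apply/seteqP; split.
  by rewrite (_ : [set _ | _] = setT)//; apply/seteqP; split.
have mq : @measurable _ (g_sigma_algebraType G) [set w | (p q.1 w <= beta q.2)%R].
  apply: sub_sigma_algebra; have [q1|q1] := boolP (q.1 \in I1).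
    exists (p q.1); first by right; exists q.1.
    exists [set` `]-oo, beta q.2]]; first exact: measurable_itv.
    by rewrite setTI; apply/seteqP; split => w /=; rewrite in_itv.
  have q0 : q.1 \in I0.
    by have := finset.in_setT q.1; rewrite -I01_cover finset.in_setU (negbTE q1) orbF.
  exists (fun w => (p q.1 w <= beta q.2)%R%:R).
    have qn : (q.2 <= n)%N by rewrite -ltnS.
    left; exists q.1, (beta q.2); split => //; first exact: Tb.
    by apply: bmono => //; move: qj; rewrite (negbTE q1).
  exists [set 1]; first exact: measurable_set1.
  rewrite setTI; apply/seteqP; split => w /=; last by move=> ->.
  by case: (p q.1 w <= _) => // /eqP; rewrite eq_sym oner_eq0.
case: (x q); last have {}mq := measurableC mq.
  by rewrite (_ : [set w | _] = [set w | (p q.1 w <= beta q.2)%R])//;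
    apply/seteqP; split => w /=; rewrite !ffunE qj andbT.
by rewrite (_ : [set w | _] = ~` [set w | (p q.1 w <= beta q.2)%R])//;
    apply/seteqP; split => w /=; rewrite !ffunE qj andbT; [move->|move/negP/negbTE].
Qed.

End states.

(** * The step down test in terms of the array *)

Section step_down_index.
Variables (d : measure_display) (Omega : measurableType d) (R : realType).
Variables (P : probability Omega R) (n : nat) (p : 'I_n -> {RV P >-> R}).
Variables (beta : nat -> R) (I0 I1 : {set 'I_n}).
Hypothesis I01_cover : (I0 :|: I1 = [set: 'I_n])%SET.
Hypothesis I01_disjoint : (I0 :&: I1 = finset.set0)%SET.

Lemma ordered_pvalue_le w j t : (0 < j <= n)%N ->
  (ordered_pvalue p w j <= t) = (j <= \sum_(i < n) (p i w <= t)%R)%N.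
Proof.
move=> /andP[j0 jn]; rewrite /ordered_pvalue; set s := sort _ _.
have <- : count (<= t) s = (\sum_(i < n) (p i w <= t)%R)%N.
  rewrite count_sort count_map -sum1_count big_enum_cond big_mkcond/=.
  by apply: eq_bigr => i _; case: ifP.
have ss : sorted <=%O s by apply: sort_sorted; exact: le_total.
have sz : size s = n by rewrite size_sort size_map size_enum_ord.
have [jc|cj] := leqP j (count (<= t) s); first by apply: nth_count_le; lia.
by apply/negbTE; rewrite -ltNge; apply: nth_count_gt => //; rewrite sz -ltnS prednK// cj.
Qed.

Lemma all_ordered_pvalue_le w i : (i <= n)%N ->
  all (fun j => ordered_pvalue p w j <= beta j) (iota 1 i) =
  reached (ncount I0) (ncount I1) i (state p beta w).
Proof.
move=> iin; apply: eq_in_all => j; rewrite mem_iota => /andP[j0 ji].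
rewrite ordered_pvalue_le; last by lia.
rewrite ncountD//; congr (_ <= _)%N; apply: eq_bigr => k _.
by rewrite ffunE/= inordK//; lia.
Qed.

Lemma tau_SD_stop w : beta 0 = 0 ->
  {in [pred i | (i <= n)%N] &, {homo beta : i j / (i <= j)%N >-> i <= j}} ->
  tau_SD p beta w = beta (stop n (ncount I0) (ncount I1) (state p beta w)).
Proof.
move=> beta0 bmono; set k := stop _ _ _ _.
have kn : (k <= n)%N by exact: stop_le.
apply/eqP; rewrite eq_le; apply/andP; split; rewrite /tau_SD big_seq_cond.
  apply: bigmax_le => [|i]; first by rewrite -beta0 bmono.
  rewrite mem_index_iota => /andP[/andP[i0 iin] Qi].
  apply: bmono; rewrite ?inE//.
  by rewrite -(@reachedE _ n)// -all_ordered_pvalue_le.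
have [k0|k0] := posnP k; first by rewrite k0 beta0 bigmax_ge_id.
apply: (bigmax_sup_seq _ k) => //; rewrite mem_index_iota k0 ltnS kn//=.
by rewrite all_ordered_pvalue_le// (@reachedE _ n).
Qed.

Lemma M_null_state alpha j w : beta = beta_SD n alpha -> (j <= n)%N ->
  M_null p I0 (beta j) w =
  compensated n #|I0| alpha (ncount I0) j (state p beta w).
Proof.
move=> betaE jn; rewrite /M_null /compensated -pcount_state// -mulr_suml.
by rewrite sumrB sumr_const betaE mulr_natl.
Qed.

End step_down_index.

Lemma ratio_le (R : realType) (v s : nat) :
  v%:R / (v%:R + s%:R) <= v%:R / (s%:R + 1) :> R.
Proof.
case: v => [|v]; first by rewrite !mul0r.
rewrite ler_pM2l ?ltr0n// lef_pV2 ?posrE -?natrD ?natr1 ?ltr0n ?addSn//.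
by rewrite ler_nat; lia.
Qed.

Lemma ratioE (R : realType) (v s : nat) :
  v%:R / (v%:R + s%:R) = v%:R / (s%:R + 1) -
    (v%:R * (v%:R - 1)) / ((v%:R + s%:R) * (s%:R + 1)) :> R.
Proof.
case: v => [|v]; first by rewrite !mul0r subr0.
have h1 : v.+1%:R + s%:R != 0 :> R by rewrite -natrD pnatr_eq0.
have h2 : s%:R + 1 != 0 :> R by rewrite natr1 pnatr_eq0.
by move: h1 h2; move: v.+1%:R s%:R => a b h1 h2; field; rewrite ?h1 ?h2.
Qed.

(** * The bounds on the false discovery rate *)

Theorem theorem14 (d : measure_display) (Omega : measurableType d)
    (R : realType) (P : probability Omega R)
    (n : nat) (n_ge1 : (1 <= n)%N)
    (alpha : R) (alpha_gt0 : 0 < alpha) (alpha_lt1 : alpha < 1)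
    (p : 'I_n -> {RV P >-> R})
    (p01 : forall i w, 0 <= p i w <= 1)
    (I0 I1 : {set 'I_n})
    (I01_cover : (I0 :|: I1 = [set: 'I_n])%SET)
    (I01_disjoint : (I0 :&: I1 = finset.set0)%SET)
    (n0_gt0 : (0 < #|I0|)%N)
    (null_bound : forall t : R, 0 <= t < 1 ->
       ('E_P[pcount p I0 t] <= (#|I0|%:R * t)%:E)%E) :
  let beta := beta_SD n alpha in
  let T := time_set n beta in
  let tau := tau_SD p beta in
  let V := fun w => pcount p I0 (tau w) w in
  let S := fun w => pcount p I1 (tau w) w in
  let Rej := fun w => V w + S w in
  martingale P T (filtration_f p T I0 I1) (M_null p I0) ->
  [/\ ('E_P[fun w => (V w / Rej w)%R]
         <= 'E_P[fun w => (V w / (S w + 1))%R])%E,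
      ('E_P[fun w => (V w / (S w + 1))%R] <= (alpha / (1 - alpha))%:E)%E &
      ('E_P[fun w => (V w / Rej w)%R]
         <= (alpha / (1 - alpha))%:E -
            'E_P[fun w => ((V w * (V w - 1)) / (Rej w * (S w + 1)))%R])%E].
Proof.
move=> beta T tau V S Rej [[F_sub _] _ _ M_cond].
pose st := state p beta.
pose pr x := fine (P (st @^-1` [set x])).
pose v x := ncount I0 (stop n (ncount I0) (ncount I1) x) x.
pose s x := ncount I1 (stop n (ncount I0) (ncount I1) x) x.
have beta0 : beta 0 = 0 by exact: beta_SD0.
have bmono : {in [pred i | (i <= n)%N] &, {homo beta : i j / (i <= j)%N >-> i <= j}}.
  move=> i j _ /= jn; rewrite leq_eqVlt => /predU1P[->//|ij].
  by apply/ltW/beta_SD_lt.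
have T_beta i : (i <= n)%N -> T (beta i).
  by case: i => [|i] iin; [left|right; exists i.+1].
have mst x : measurable (st @^-1` [set x]) by exact: measurable_state.
have VE w : V w = (v (st w))%:R.
  by rewrite /V /tau (tau_SD_stop p I01_cover I01_disjoint)// pcount_state// stop_le.
have SE w : S w = (s (st w))%:R.
  by rewrite /S /tau (tau_SD_stop p I01_cover I01_disjoint)// pcount_state// stop_le.
have E_mean h : ('E_P[fun w => h (st w)] = (mean pr h)%:E)%E.
  exact: expectation_finite_valued.
have pr_ge0 x : 0 <= pr x by rewrite fine_ge0.
have pr_gt0 x : 0 < pr x -> exists w, st w = x.
  move=> px; apply: contrapT => nw; move: px; rewrite /pr.
  rewrite (_ : _ @^-1` _ = set0) ?measure0 ?ltxx//.
  by apply/seteqP; split => // w /= wx; apply: nw; exists w.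
(* the middle inequality; the other two are deduced from it pointwise *)
have ratio_bound :
    mean pr (fun x => (v x)%:R / ((s x)%:R + 1)) <= alpha / (1 - alpha).
  apply: (@mean_ratio_le _ _ pr n #|I0| #|I1| alpha _ _ (truncate I1)) => //.
  (* the masses add up to [1] *)
  - have := E_mean (fun=> 1); rewrite expectation_cst => -[].
    by rewrite /mean => ->; apply: eq_bigr => x _; rewrite mulr1.
  - by rewrite -cardsUI I01_cover I01_disjoint cards0 addn0 cardsT card_ord.
  - by move=> *; exact: ncount_le.
  - by move=> *; exact: ncount_le.
  - by move=> x j /pr_gt0[w <-] jn; apply: ncount_mono => //; rewrite bmono ?inE// ltnW.
  - by move=> x j /pr_gt0[w <-] jn; apply: ncount_mono => //; rewrite bmono ?inE// ltnW.
  - move=> i j x ij; exact: ncount_truncate_null.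
  - by move=> *; exact: ncount_truncate_alt.
  (* the bound on the null p-values, used at [t = 0] only *)
  - rewrite -lee_fin -E_mean; have := null_bound 0; rewrite lexx ltr01 mulr0.
    move=> /(_ isT); rewrite (_ : pcount p I0 0 = fun w => (ncount I0 0 (st w))%:R)//.
    by apply/funext => w; rewrite -pcount_state// beta0.
  (* the martingale property, tested on the event [A] that [y] is visible *)
  - move=> j y jn; pose A := (truncate I1 j \o st) @^-1` [set y].
    have FA : filtration_f p T I0 I1 (beta j) A.
      by apply: filtration_f_truncate => //; exact: ltnW.
    have [_ F_meas] := F_sub _ (T_beta j (ltnW jn)).
    have mA : measurable A by exact: F_meas.
    have bj : beta j <= beta j.+1 by rewrite bmono ?inE// ltnW.
    have [_ _ /(_ A FA)] := M_cond _ _ (T_beta j (ltnW jn)) (T_beta _ jn) bj.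
    pose X j := compensated n #|I0| alpha (ncount I0) j.
    have ME i : (i <= n)%N -> M_null p I0 (beta i) = fun w => X i (st w).
      by move=> iin; apply/funext => w; exact: M_null_state.
    rewrite !ME// ?(ltnW jn)//.
    rewrite !(integral_finite_valued P mst _ mA) => -[] /eqP.
    rewrite eq_sym -subr_eq0 -sumrB => /eqP diff0; rewrite -[RHS]diff0 [LHS]big_mkcond.
    apply: eq_bigr => x _; rewrite -mulrBr; case: eqP => [xy|xy].
      congr (fine (P _) * _); rewrite setIidl// => w /= wx.
      by rewrite /A /= wx.
    rewrite (_ : _ `&` _ = set0) ?measure0 ?mul0r//.
    by apply/seteqP; split => // w [/= wx]; rewrite /A /= wx.
have -> : (fun w => V w / Rej w) = (fun w => ((v (st w))%:R / ((v (st w))%:R + (s (st w))%:R))).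
  by apply/funext => w; rewrite /Rej VE SE.
have -> : (fun w => V w / (S w + 1)) = (fun w => ((v (st w))%:R / ((s (st w))%:R + 1))).
  by apply/funext => w; rewrite VE SE.
pose h x : R := ((v x)%:R * ((v x)%:R - 1)) / (((v x)%:R + (s x)%:R) * ((s x)%:R + 1)).
have -> : (fun w => (V w * (V w - 1)) / (Rej w * (S w + 1))) = (fun w => h (st w)).
  by apply/funext => w; rewrite /Rej VE SE.
rewrite (E_mean (fun x => (v x)%:R / ((v x)%:R + (s x)%:R))).
rewrite (E_mean (fun x => (v x)%:R / ((s x)%:R + 1))) E_mean.
rewrite -EFinB !lee_fin; split => //.
  by apply: ler_mean => // x _; exact: ratio_le.
rewrite lerBrDr -meanD; apply: le_trans ratio_bound.
by apply: ler_mean => // x _; rewrite ratioE subrK.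
Qed.
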